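(* Let $X$ be a real Banach space and $p\in\mathrm{Sem}(X)$. Then the following conditions are equivalent: (i) $p$ attains its norm as an element of $\ell_\infty(S_X,\mathbb{R})$, i.e. there exists $z\in S_X$ such that $p(z)=\|p\|$; (ii) $p\in\mathrm{SA}(X)$, i.e. there exists a pair $(x,y)\in X\times X$ with $x\neq y$ such that $\frac{|p(x)-p(y)|}{\|x-y\|}=\|p\|$; (iii) $p\in\mathrm{DA}(X)$, i.e. there exists a sequence of pairs $\{(x_n,y_n)\}$ in $X\times X$ with $x_n\neq y_n$ for all $n$ such that $\left\{\frac{x_n-y_n}{\|x_n-y_n\|}\right\}$ is convergent and $\frac{p(x_n)-p(y_n)}{\|x_n-y_n\|}\to\|p\|$; (iv) for every Banach space $Y$ and every operator $T\in L(X,Y)$ such that $p(x)=\|Tx\|$ for all $x\in X$, $T$ attains its norm, i.e. there is $z\in S_X$ such that $\|Tz\|=\|T\|=\|p\|$; (v) there exist a Banach space $Y$ and a norm attaining operator $T\in L(X,Y)$ such that $p(x)=\|Tx\|$ for all $x\in X$.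
   Context: All Banach spaces are real. $S_X$ is the unit sphere of $X$, and $\ell_\infty(S_X,\mathbb{R})$ is the Banach space of bounded real functions on $S_X$ with the uniform norm. $\mathrm{Sem}(X)$ is the set of all continuous seminorms on $X$. For $p\in\mathrm{Sem}(X)$, $\|p\|=\sup_{z\in S_X}p(z)$, which coincides with the Lipschitz norm $\sup\left\{\frac{|p(x)-p(y)|}{\|x-y\|}:x\neq y\in X\right\}$. $L(X,Y)$ is the space of bounded linear operators from $X$ to $Y$ with the operator norm; $T\in L(X,Y)$ is norm attaining if $\|Tz\|=\|T\|$ for some $z\in S_X$. *)

(* Defs.v *)
From HB Require Import structures.
From mathcomp Require Import all_boot all_order all_algebra.
From mathcomp Require Import all_classical all_reals topology normedtype.

Set Implicit Arguments.
Unset Strict Implicit.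
Unset Printing Implicit Defensive.

Import Order.TTheory GRing.Theory Num.Theory.
Import numFieldNormedType.Exports.

Local Open Scope classical_set_scope.
Local Open Scope ring_scope.

Definition unit_sphere {R : realType} (X : normedModType R) : set X :=
  [set z | `|z| = 1].
Arguments unit_sphere {R} X _.

Definition unit_ball {R : realType} (X : normedModType R) : set X :=
  [set z | `|z| <= 1].
Arguments unit_ball {R} X _.

Record continuous_seminorm {R : realType} {X : normedModType R} (p : X -> R) :
    Prop := {
  seminorm_ge0 : forall x, 0 <= p x;
  seminormD : forall x y, p (x + y) <= p x + p y;
  seminormZ : forall (a : R) x, p (a *: x) = `|a| * p x;
  seminorm_continuous : continuous p }.

(* On the zero space the sphere is empty and the norm is sup set0 = 0. *)
Definition seminorm_norm {R : realType} {X : normedModType R} (p : X -> R) : R :=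
  sup [set p z | z in unit_sphere X].

Definition SA {R : realType} {X : normedModType R} (p : X -> R) : Prop :=
  exists x y : X, x != y /\ `|p x - p y| / `|x - y| = seminorm_norm p.

Definition DA {R : realType} {X : normedModType R} (p : X -> R) : Prop :=
  exists x y : nat -> X,
    [/\ forall n, x n != y n,
        cvg ((fun n => `|x n - y n|^-1 *: (x n - y n)) @ \oo) &
        (fun n => (p (x n) - p (y n)) / `|x n - y n|) @ \oo
          --> seminorm_norm p].

(* For linear T, being bounded near 0 is being a bounded operator: see
   linear_boundedP. *)
Definition bounded_operator {R : realType} {X Y : normedModType R}
  (T : {linear X -> Y}) : Prop := bounded_near T (nbhs (0 : X)).

Definition operator_norm {R : realType} {X Y : normedModType R}
  (T : {linear X -> Y}) : R := sup [set `|T x| | x in unit_ball X].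

Definition norm_attaining {R : realType} {X Y : normedModType R}
  (T : {linear X -> Y}) : Prop :=
  exists2 z, unit_sphere X z & `|T z| = operator_norm T.

(* Main.v *)
(* If (x_n, y_n) realises the norm of p and the normalised differences
   converge to z, then p (x_n) - p (y_n) <= p (x_n - y_n) gives p z >= ||p||, so
   (iii) yields a norming point on the sphere.  Condition (iv) is only useful
   once p is known to factor as p = ||T _|| through some Banach space.  For
   this, Hahn-Banach provides for each v a linear f_v with |f_v| <= p and
   f_v v = p v, and T x := (v |-> f_v x) takes values in l_infty(X).
   Hahn-Banach is obtained without extending functionals from subspaces: a
   minimal sublinear functional is odd, hence linear. *)
Require Import Defs.
From HB Require Import structures.
From mathcomp Require Import all_boot all_order all_algebra.
From mathcomp Require Import all_classical all_reals topology normedtype.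
From mathcomp Require Import lra.

Set Implicit Arguments.
Unset Strict Implicit.
Unset Printing Implicit Defensive.

Import Order.TTheory GRing.Theory Num.Theory.
Import numFieldNormedType.Exports.

Local Open Scope classical_set_scope.
Local Open Scope ring_scope.

(** * Sublinear functionals and a Hahn-Banach theorem *)

Section HahnBanach.
Variables (R : realType) (V : lmodType R).
Implicit Types (p q : V -> R) (v x y : V).

(** Homogeneity is an inequality because that is what infima yield directly; [sublinearZ] recovers
    equality by scaling back with the inverse. *)
Definition sublinear q :=
  (forall x y, q (x + y) <= q x + q y) /\
  (forall a x, 0 <= a -> q (a *: x) <= a * q x).

Lemma sublinear0 q : sublinear q -> q 0 = 0.
Proof.
move=> [qD qZ]; have := qD 0 0; have := qZ 0 0 (lexx 0).
rewrite scale0r addr0; lra.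
Qed.

Lemma sublinearZ q a x : sublinear q -> 0 <= a -> q (a *: x) = a * q x.
Proof.
move=> sq; rewrite le_eqVlt => /predU1P[<-|a0].
  by rewrite scale0r sublinear0// mul0r.
have [_ qZ] := sq; apply/eqP; rewrite eq_le (qZ _ _ (ltW a0))/=.
rewrite -ler_pdivlMl//.
by rewrite -{1}[x](scalerK (lt0r_neq0 a0)) qZ// invr_ge0 ltW.
Qed.

Lemma sublinear_geN q x : sublinear q -> - q (- x) <= q x.
Proof.
by move=> sq; have := sq.1 x (- x); rewrite subrr sublinear0//; lra.
Qed.

(** Oddness turns subadditivity at [- x] and [- y] into superadditivity at [x] and [y], and reduces
    negative scalars to positive ones. *)
Lemma sublinear_odd q : sublinear q -> (forall x, q (- x) <= - q x) ->
  scalar q.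
Proof.
move=> sq qN.
have qNE x : q (- x) = - q x.
  by apply/eqP; rewrite eq_le qN lerNl sublinear_geN.
have qD x y : q (x + y) = q x + q y.
  apply/eqP; rewrite eq_le sq.1 /= -lerN2 opprD -!qNE opprD.
  exact: sq.1.
move=> a x y; rewrite qD; congr (_ + _).
have [a0|a0] := leP 0 a; first exact: sublinearZ.
have := @sublinearZ q (- a) x sq; rewrite oppr_ge0 ltW// scaleNr qNE mulNr.
by move=> /(_ isT)/oppr_inj.
Qed.

(* The witness that a sublinear functional which is not odd at v is not
   minimal: it lies below q and is at most - q v at - v. *)
Definition shear q v x :=
  inf [set q (x + t *: v) - t * q v | t in [set t | 0 <= t]].

Lemma shear_has_lbound q v x : sublinear q ->
  has_lbound [set q (x + t *: v) - t * q v | t in [set t | 0 <= t]].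
Proof.
(* The bound comes from [t * q v = q (t *: v) <= q (x + t *: v) + q (- x)]. *)
move=> sq; exists (- q (- x)) => _ [t t0 <-].
have := sq.1 (x + t *: v) (- x); rewrite addrAC subrr add0r sublinearZ//.
lra.
Qed.

Lemma shear_le q v x t : sublinear q -> 0 <= t ->
  shear q v x <= q (x + t *: v) - t * q v.
Proof.
by move=> sq t0; apply: (ge_inf (shear_has_lbound v x sq)); exists t.
Qed.

Lemma le_shear q v x b :
  (forall t, 0 <= t -> b <= q (x + t *: v) - t * q v) -> b <= shear q v x.
Proof.
move=> H; apply: lb_le_inf; last by move=> _ [t t0 <-]; exact: H.
by exists (q (x + 0 *: v) - 0 * q v), 0 => /=.
Qed.

Lemma shear_le_id q v x : sublinear q -> shear q v x <= q x.
Proof.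
move=> sq; have := shear_le v x sq (lexx 0).
by rewrite scale0r addr0 mul0r subr0.
Qed.

Lemma shearN q v : sublinear q -> shear q v (- v) <= - q v.
Proof.
move=> sq; have := shear_le v (- v) sq ler01.
by rewrite scale1r addNr mul1r sublinear0// add0r.
Qed.

(** Parameters [s] for [x] and [t] for [y] combine into [s + t] for [x + y]; for a scalar [a > 0],
    parameter [t] for [x] becomes [a * t] for [a *: x]. *)
Lemma shear_sublinear q v : sublinear q -> sublinear (shear q v).
Proof.
move=> sq; split=> [x y|a x].
  rewrite -lerBlDl; apply: le_shear => t t0.
  rewrite lerBlDr -lerBlDl; apply: le_shear => s s0.
  have := shear_le v (x + y) sq (addr_ge0 s0 t0).
  have := sq.1 (x + s *: v) (y + t *: v).
  rewrite addrACA -scalerDl; lra.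
rewrite le_eqVlt => /predU1P[<-|a0].
  by rewrite scale0r mul0r (le_trans (shear_le_id _ _ sq))// sublinear0.
rewrite -ler_pdivrMl//; apply: le_shear => t t0.
rewrite ler_pdivrMl// mulrBr -(sublinearZ _ sq (ltW a0)) scalerDr scalerA mulrA.
by apply: shear_le => //; rewrite mulr_ge0// ltW.
Qed.

(** Zorn's lemma for the reversed pointwise order on the sublinear functionals below [p]: a nonempty
    chain is bounded by its pointwise infimum, the empty one by [p]. *)
Lemma minimal_sublinear p : sublinear p -> exists q,
  [/\ sublinear q, forall x, q x <= p x
    & forall r, sublinear r -> (forall x, r x <= q x) -> r = q].
Proof.
move=> sp; pose T := {q | sublinear q /\ forall x, q x <= p x}.
have sT (t : T) : sublinear (sval t) by case: (svalP t).
have pT (t : T) x : sval t x <= p x by case: (svalP t).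
pose R' (s t : T) := `[< forall x, sval t x <= sval s x >].
have [||||[q [sq qp]] qmin] := @Zorn T R'.
- by move=> t; apply/asboolP => x.
- move=> r s t /asboolP rs /asboolP st; apply/asboolP => x.
  exact: le_trans (st x) (rs x).
- move=> s t /asboolP st /asboolP ts; apply: eq_sig_hprop.
    by move=> ? ? ?; exact: Prop_irrelevance.
  by apply/funext => x; apply/eqP; rewrite eq_le st ts.
- move=> A Atot; have [->|/set0P[t0 At0]] := eqVneq A set0.
    by exists (exist _ p (conj sp (fun=> lexx _))).
  pose m x := inf [set sval t x | t in A].
  have mle t x : A t -> m x <= sval t x.
    move=> At; apply: ge_inf; last by exists t.
    (* The infimum is finite since [- p (- x) <= - s (- x) <= s x] for every member [s]. *)
    exists (- p (- x)) => _ [s _ <-].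
    by rewrite (le_trans _ (sublinear_geN x (sT s)))// lerN2 pT.
  have lem x b : (forall t, A t -> b <= sval t x) -> b <= m x.
    move=> H; apply: lb_le_inf; last by move=> _ [t At <-]; exact: H.
    by exists (sval t0 x), t0.
  have sm : sublinear m.
    split=> [x y|a x a0].
      rewrite -lerBlDl; apply/lem => t At; rewrite lerBlDr -lerBlDl.
      apply/lem => s As; rewrite lerBlDl.
      (* Subadditivity of the smaller of [s] and [t] bounds the infimum at [x + y] by
         [s x + t y]. *)
      have [/asboolP ts|/asboolP st] := Atot _ _ At As.
        rewrite (le_trans (mle _ _ As))// (le_trans ((sT s).1 x y))//.
        by rewrite addrC lerD2r.
      rewrite (le_trans (mle _ _ At))// (le_trans ((sT t).1 x y))//.
      by rewrite addrC lerD2l.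
    move: a0; rewrite le_eqVlt => /predU1P[<-|a0].
      by rewrite scale0r mul0r (le_trans (mle _ _ At0))// sublinear0.
    rewrite -ler_pdivrMl//; apply/lem => t At.
    by rewrite ler_pdivrMl// -(sublinearZ _ (sT t) (ltW a0)) mle.
  have mp x : m x <= p x by rewrite (le_trans (mle _ _ At0)).
  by exists (exist _ m (conj sm mp)) => s As; apply/asboolP => x; exact: mle.
exists q; split => // r sr rq.
have rp x : r x <= p x by rewrite (le_trans (rq x)).
by have [] := qmin (exist _ r (conj sr rp)) (asboolT rq).
Qed.

(* Minimality below [shear p v], rather than below [p], is what forces the
   value at v. *)
Lemma hahn_banach p v : sublinear p -> exists f : V -> R,
  [/\ scalar f, forall x, f x <= p x & f v = p v].
Proof.
move=> sp; have := minimal_sublinear (shear_sublinear v sp).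
move=> [f [sf fp fmin]].
have fN x : f (- x) <= - f x.
  (* By minimality [f] equals its own shear along any [x], and is therefore odd. *)
  have flow := fmin _ (shear_sublinear x sf) (fun y => shear_le_id x y sf).
  by rewrite -{1}flow shearN.
exists f; split; first exact: sublinear_odd.
  by move=> x; rewrite (le_trans (fp x))// shear_le_id.
(* The lower bound is the chain [f v >= - f (- v) >= - shear p v (- v) >= p v]. *)
apply/eqP; rewrite eq_le (le_trans (fp v)) ?shear_le_id//=.
have := fp (- v); have := shearN v sp; have := sublinear_geN v sf; lra.
Qed.

End HahnBanach.

(** * The Banach space of bounded real functions on a pointed type *)

Section BoundedFunctions.
Variables (R : realType) (I : pointedType).

Definition bounded_functions : {pred I -> R^o} :=
  mem [set f : I -> R^o | exists M, forall i, `|f i| <= M].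

Lemma bounded_functions_submod_closed : submod_closed bounded_functions.
Proof.
split=> [|a f g]; first by rewrite inE; exists 0 => i; rewrite normr0.
rewrite !inE => -[M fM] [N gN]; exists (`|a| * M + N) => i.
by rewrite (le_trans (ler_normD _ _))// lerD// normrM ler_wpM2l.
Qed.

HB.instance Definition _ :=
  GRing.isSubmodClosed.Build R (I -> R^o) bounded_functions
    bounded_functions_submod_closed.

Record linfty := Linfty {
  linfty_fun :> I -> R^o;
  linfty_funP : linfty_fun \in bounded_functions }.

HB.instance Definition _ := [isSub for linfty_fun].
HB.instance Definition _ := [Choice of linfty by <:].
HB.instance Definition _ := [SubChoice_isSubLmodule of linfty by <:].

Implicit Types f g : linfty.

(** The base point of [I] makes the range nonempty, so the supremum is a genuine one. *)
Definition linfty_norm f : R := sup (range (fun i => `|f i|)).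

Lemma linfty_norm_ub f i : `|f i| <= linfty_norm f.
Proof.
have /set_mem[M fM] := linfty_funP f.
by apply: ub_le_sup; [exists M => _ [j _ <-]|exists i].
Qed.

Lemma linfty_norm_le f M : (forall i, `|f i| <= M) -> linfty_norm f <= M.
Proof.
by move=> fM; apply: ge_sup => [|_ [i _ <-]//]; exists `|f point|, point.
Qed.

Lemma linfty_normD f g : linfty_norm (f + g) <= linfty_norm f + linfty_norm g.
Proof.
apply: linfty_norm_le => i; rewrite (le_trans (ler_normD _ _))//.
by rewrite lerD// linfty_norm_ub.
Qed.

Lemma linfty_normZ_le (a : R) f : linfty_norm (a *: f) <= `|a| * linfty_norm f.
Proof.
apply: linfty_norm_le => i; rewrite [leLHS]normrM.
by rewrite ler_wpM2l// linfty_norm_ub.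
Qed.

Lemma linfty_normZ (a : R) f : linfty_norm (a *: f) = `|a| * linfty_norm f.
Proof.
apply/eqP; rewrite eq_le linfty_normZ_le/=.
have [->|a0] := eqVneq a 0.
  by rewrite normr0 mul0r (le_trans _ (linfty_norm_ub _ point)).
(* The reverse inequality is the first one applied to [a^-1] and [a *: f]. *)
rewrite -ler_pdivlMl ?normr_gt0// -normfV.
by rewrite (le_trans _ (linfty_normZ_le _ _))// scalerK.
Qed.

Lemma linfty_norm0_eq0 f : linfty_norm f = 0 -> f = 0.
Proof.
move=> f0; apply/val_inj/funext => i; apply/eqP.
by rewrite -normr_le0 -f0 linfty_norm_ub.
Qed.

HB.instance Definition _ := Lmodule_isNormed.Build R linfty
  linfty_normD linfty_normZ linfty_norm0_eq0.

(** The limit is taken pointwise in the reals. Uniform closeness to a fixed centre [g] survives this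
    limit, which gives both its boundedness and uniform convergence. *)
Lemma linfty_complete (F : set_system linfty) :
  ProperFilter F -> cauchy F -> cvg F.
Proof.
move=> FF /cauchyP Fc.
pose ev i (f : linfty) : R := f i.
have near_center (e : R) : 0 < e -> exists g : linfty,
    F [set f : linfty | forall i, `|g i - f i| < e].
  move=> /Fc[g Fg]; exists g; apply: filterS Fg => f.
  rewrite -ball_normE => gf i; apply: le_lt_trans gf.
  exact: (linfty_norm_ub (g - f)).
have cvg_ev i : cvg (ev i @ F).
  apply/cauchy_cvgP/cauchy_exP => e /near_center[g Fg].
  exists (g i); suff : F [set f | ball (g i) e (ev i f)] by [].
  by apply: filterS Fg => f gf; rewrite -ball_normE; exact: gf.
pose l i : R^o := lim (ev i @ F).
have near_lim (e : R) : 0 < e -> exists2 g : linfty,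
    F [set f : linfty | forall i, `|g i - f i| < e]
    & forall i, `|g i - l i| <= e.
  move=> /near_center[g Fg]; exists g => // i.
  have gl : `|g i - ev i f| @[f --> F] --> `|g i - l i|.
    by apply: cvg_norm; apply: cvgB; [exact: cvg_cst|exact: cvg_ev].
  by apply: (cvgr_to_le gl); apply: filterS Fg => f gf; exact/ltW/gf.
have lP : l \in bounded_functions.
  have [g _ gl] := near_lim 1 ltr01.
  rewrite inE; exists (1 + linfty_norm g) => i.
  rewrite -[l i](subrK (g i)) (le_trans (ler_normD _ _))//.
  by rewrite lerD ?linfty_norm_ub// distrC.
apply/cvg_ex; exists (Linfty lP); apply/cvgrPdist_le => e e0.
(* The centre [g] is within [e / 2] of the limit and of [F]-most [f]. *)
have [g Fg gl] := near_lim (e / 2) (divr_gt0 e0 (ltr0n _ 2)).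
apply: filterS Fg => f gf; apply: linfty_norm_le => i /=.
rewrite [leLHS](_ : _ = `|(l i - g i) + (g i - f i)|); last first.
  by rewrite addrA subrK.
rewrite (le_trans (ler_normD _ _))// [leRHS]splitr.
by rewrite lerD ?(ltW (gf i))// distrC.
Qed.

HB.instance Definition _ := Uniform_isComplete.Build linfty linfty_complete.

End BoundedFunctions.

(** * Norms, norming points and factorisations of continuous seminorms *)

Section ContinuousSeminorms.
Variables (R : realType) (X : normedModType R) (p : X -> R).
Variable hp : continuous_seminorm p.

Lemma seminorm0 : p 0 = 0.
Proof. by rewrite -(scale0r (0 : X)) (seminormZ hp) normr0 mul0r. Qed.

Lemma seminormN x : p (- x) = p x.
Proof. by rewrite -scaleN1r (seminormZ hp) normrN1 mul1r. Qed.

Lemma seminorm_sub_le x y : p x - p y <= p (x - y).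
Proof. by rewrite lerBlDr (le_trans _ (seminormD hp _ _))// subrK. Qed.

Lemma seminorm_bounded : exists2 M, 0 < M & forall x, p x <= M * `|x|.
Proof.
have /cvgrPdist_lt/(_ 1 ltr01) := seminorm_continuous hp (x := 0).
rewrite -nbhs_ballE => -[d /= d0 dp].
(* On the ball of radius [d] the seminorm is below 1; rescaling [x] to norm [d / 2] gives the
   constant [2 / d]. *)
exists (2 / d) => [|x]; first by rewrite divr_gt0.
have [->|x0] := eqVneq x 0; first by rewrite seminorm0 normr0 mulr0.
have nx0 : 0 < `|x| by rewrite normr_gt0.
have c0 : 0 < d / 2 / `|x| by rewrite !divr_gt0.
have := dp ((d / 2 / `|x|) *: x).
rewrite -ball_normE /= sub0r normrN normrZ gtr0_norm// divfK ?gt_eqF//.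
rewrite seminorm0 sub0r normrN ger0_norm ?(seminorm_ge0 hp)//.
rewrite (seminormZ hp) gtr0_norm// => /(_ _)/ltW H.
have : d / 2 / `|x| * p x <= 1 by apply: H; lra.
rewrite -ler_pdivlMl// mulr1 !invf_div; congr (_ <= _).
by rewrite mulrC.
Qed.

Lemma seminorm_norm_has_ubound : has_ubound [set p z | z in unit_sphere X].
Proof.
have [M M0 pM] := seminorm_bounded.
by exists M => _ [z z1 <-]; rewrite -[M]mulr1 -z1.
Qed.

Lemma seminorm_norm_ub z : unit_sphere X z -> p z <= seminorm_norm p.
Proof. by move=> z1; apply: (ub_le_sup seminorm_norm_has_ubound); exists z. Qed.

Lemma unit_sphere_normalize x : x != 0 -> unit_sphere X (`|x|^-1 *: x).
Proof.
move=> x0; rewrite /unit_sphere/= normrZ normfV normr_id mulVf//.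
by rewrite normr_eq0.
Qed.

Lemma le_seminorm_norm x : p x <= seminorm_norm p * `|x|.
Proof.
have [->|x0] := eqVneq x 0; first by rewrite seminorm0 normr0 mulr0.
have nx0 : 0 < `|x| by rewrite normr_gt0.
have := seminorm_norm_ub (unit_sphere_normalize x0).
by rewrite (seminormZ hp) normfV normr_id mulrC ler_pdivrMr.
Qed.

(** Links the ball of [operator_norm] to the sphere of [seminorm_norm]. The point [z] makes the
    sphere nonempty and the norm nonnegative, so [le_seminorm_norm] bounds [p] on the whole ball. *)
Lemma seminorm_norm_unit_ball z : unit_sphere X z ->
  sup [set p x | x in unit_ball X] = seminorm_norm p.
Proof.
move=> z1; have bnd x : unit_ball X x -> p x <= seminorm_norm p.
  move=> x1; rewrite (le_trans (le_seminorm_norm x))// ler_piMr//.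
  exact: le_trans (seminorm_ge0 hp z) (seminorm_norm_ub z1).
apply/eqP; rewrite eq_le; apply/andP; split.
  apply: ge_sup => [|_ [x x1 <-]]; last exact: bnd.
  by exists (p z), z => //; rewrite /unit_ball/= z1.
apply: ge_sup => [|_ [x x1 <-]]; first by exists (p z), z.
apply: ub_le_sup; last by exists x => //; rewrite /unit_ball/= x1.
by exists (seminorm_norm p) => _ [y y1 <-]; exact: bnd.
Qed.

Lemma operator_norm_seminorm (Y : normedModType R) (T : {linear X -> Y}) z :
  (forall x, p x = `|T x|) -> unit_sphere X z ->
  operator_norm T = seminorm_norm p.
Proof.
move=> pT z1; rewrite -(seminorm_norm_unit_ball z1).
by congr sup; apply: eq_imagel => x _; rewrite pT.
Qed.

Lemma sphere_attaining_SA z : unit_sphere X z -> p z = seminorm_norm p -> SA p.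
Proof.
move=> z1 pz; exists z, 0; split.
  by rewrite -normr_gt0 z1.
by rewrite seminorm0 !subr0 z1 divr1 ger0_norm// (seminorm_ge0 hp).
Qed.

Lemma SA_DA : SA p -> DA p.
Proof.
(* [SA] has an absolute value where [DA] has a signed quotient, so the pair is swapped if necessary;
   constant sequences then suffice. *)
suff oriented x y : x != y -> p y <= p x ->
    `|p x - p y| / `|x - y| = seminorm_norm p -> DA p.
  move=> [x [y [xy xyp]]]; have [yx|/ltW yx] := leP (p y) (p x).
    exact: oriented xyp.
  by apply: (oriented y x); rewrite 1?eq_sym 1?distrC// (distrC y).
move=> xy yx; rewrite ger0_norm ?subr_ge0// => xyp.
exists (fun=> x), (fun=> y); split => //; first exact: is_cvg_cst.
by rewrite xyp; exact: cvg_cst.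
Qed.

Lemma DA_sphere_attaining : DA p ->
  exists2 z, unit_sphere X z & p z = seminorm_norm p.
Proof.
move=> [x [y [xy /cvg_ex[z xyz] xyp]]].
have xy0 n : x n - y n != 0 by rewrite subr_eq0.
pose u n := `|x n - y n|^-1 *: (x n - y n).
have z1 : unit_sphere X z.
  have uz : `|u n| @[n --> \oo] --> `|z| by apply: cvg_norm; exact: xyz.
  have u1 : (fun n => `|u n|) = cst 1.
    by apply/funext => n; exact: (unit_sphere_normalize (xy0 n)).
  apply/esym; apply: (cvg_unique _ _ uz) => //.
  by rewrite u1; exact: cvg_cst.
exists z => //; apply/eqP; rewrite eq_le seminorm_norm_ub//=.
have pu : p (u n) @[n --> \oo] --> p z.
  by apply: continuous_cvg; [exact: (seminorm_continuous hp)|exact: xyz].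
apply: (ler_cvg_to xyp pu); apply: nearW => n.
rewrite /u (seminormZ hp) normfV normr_id mulrC.
by rewrite ler_wpM2l ?invr_ge0// seminorm_sub_le.
Qed.

Lemma seminorm_sublinear : sublinear p.
Proof.
split=> [x y|a x a0]; first exact: (seminormD hp).
by rewrite (seminormZ hp) ger0_norm.
Qed.

Lemma seminorm_norming_functionals : exists f : X -> X -> R,
  [/\ forall v, scalar (f v), forall v x, `|f v x| <= p x
    & forall v, f v v = p v].
Proof.
have /choice[f fP] v := hahn_banach v seminorm_sublinear.
exists f; split => [v|v x|v]; have [flin fp fv] := fP v => //.
(* With [p (- x) = p x], oddness upgrades [f v <= p] to a bound on the absolute value. *)
have fN : f v (- x) = - f v x.
  have := flin (-1) x 0; have := flin (-1) 0 0.
  by rewrite scaler0 !addr0 scaleN1r; lra.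
by rewrite ler_norml fp lerNl -fN -seminormN fp.
Qed.

Lemma seminorm_factors :
  exists (Y : completeNormedModType R) (T : {linear X -> Y}),
    bounded_operator T /\ forall x, p x = `|T x|.
Proof.
have [f [flin fp fv]] := seminorm_norming_functionals.
have fb z : ((f^~ z : X -> R^o) \in @bounded_functions R X).
  by rewrite inE; exists (p z) => v; exact: fp.
pose T0 z : linfty R X := Linfty (fb z).
have T0lin : linear T0.
  by move=> a x y; apply/val_inj/funext => v; exact: flin.
pose T : {linear X -> linfty R X} :=
  HB.pack T0 (GRing.isLinear.Build R X (linfty R X) *:%R T0 T0lin).
(* Every coordinate of [T x] is at most [p x] in absolute value, and the coordinate indexed by [x]
   itself equals [p x]. *)
have pT x : p x = `|T x|.
  apply/eqP; rewrite eq_le; apply/andP; split.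
    rewrite -(fv x) (le_trans (ler_norm _))//.
    exact: (linfty_norm_ub (T x)).
  by apply: linfty_norm_le => v; exact: fp.
exists (linfty R X), T; split => //.
have [M M0 pM] := seminorm_bounded.
apply/linear_boundedP; apply: filterS (nbhs_pinfty_ge (num_real M)) => r Mr x.
by rewrite -pT (le_trans (pM x))// ler_wpM2r.
Qed.

End ContinuousSeminorms.

(** * Equivalence of the five attainment conditions *)

Theorem lemma3p2 (R : realType) (X : completeNormedModType R) (p : X -> R)
    (hp : continuous_seminorm p) :
  [<-> exists2 z, unit_sphere X z & p z = seminorm_norm p;
       SA p;
       DA p;
       forall (Y : completeNormedModType R) (T : {linear X -> Y}),
         bounded_operator T -> (forall x, p x = `|T x|) ->
         exists z, [/\ unit_sphere X z, `|T z| = operator_norm T &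
                       operator_norm T = seminorm_norm p];
       exists (Y : completeNormedModType R) (T : {linear X -> Y}),
         [/\ bounded_operator T, norm_attaining T & forall x, p x = `|T x|]].
Proof.
do ![split].
- by move=> [z z1 pz]; exact: sphere_attaining_SA pz.
- exact: SA_DA.
(* The norming point is found from [p] alone, hence serves every factorisation. *)
- move=> /(DA_sphere_attaining hp)[z z1 pz] Y T _ pT.
  have Tp := operator_norm_seminorm hp pT z1.
  by exists z; rewrite Tp -pT.
- move=> attain; have [Y [T [Tb pT]]] := seminorm_factors hp.
  have [z [z1 Tz _]] := attain Y T Tb pT.
  by exists Y, T; split => //; exists z.
- move=> [Y [T [_ [z z1 Tz] pT]]].
  by exists z => //; rewrite pT Tz (operator_norm_seminorm hp pT z1).
Qed.
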